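(* The logic $\mathcal{DHMSH}$ is implicative (in the sense of Rasiowa) with respect to the connective $\to_H$.
   Context: Language: $\langle\vee,\wedge,\to,\sim,\bot,\top\rangle$ of arities $2,2,2,1,0,0$; formulas are built over a countably infinite set of propositional variables. The abbreviation $\alpha\to_H\beta$ stands for $\alpha\to(\alpha\wedge\beta)$. The dually hemimorphic semi-Heyting logic $\mathcal{DHMSH}$ is the Hilbert-style logic with axiom schemes: (A1) $\alpha\to_H(\alpha\vee\beta)$; (A2) $\beta\to_H(\alpha\vee\beta)$; (A3) $(\alpha\to_H\gamma)\to_H[(\beta\to_H\gamma)\to_H((\alpha\vee\beta)\to_H\gamma)]$; (A4) $(\alpha\wedge\beta)\to_H\alpha$; (A5) $(\gamma\to_H\alpha)\to_H[(\gamma\to_H\beta)\to_H(\gamma\to_H(\alpha\wedge\beta))]$; (A6) $\top$; (A7) $\bot\to_H\alpha$; (A8) $((\alpha\wedge\beta)\to_H\gamma)\to_H(\alpha\to_H(\beta\to_H\gamma))$; (A9) $(\alpha\to_H(\beta\to_H\gamma))\to_H((\alpha\wedge\beta)\to_H\gamma)$; (A10) $(\alpha\to_H\beta)\to_H((\beta\to_H\alpha)\to_H((\alpha\to\gamma)\to_H(\beta\to\gamma)))$; (A11) $(\alpha\to_H\beta)\to_H((\beta\to_H\alpha)\to_H((\gamma\to\beta)\to_H(\gamma\to\alpha)))$; (A12) $\top\to_H{\sim}\bot$; (A13) ${\sim}\top\to_H\bot$; (A14) ${\sim}(\alpha\wedge\beta)\to_H({\sim}\alpha\vee{\sim}\beta)$;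 and rules (SMP): from $\phi$ and $\phi\to_H\gamma$ deduce $\gamma$; (SCP): from $\phi\to_H\gamma$ deduce ${\sim}\gamma\to_H{\sim}\phi$. $\Gamma\vdash\phi$ means that $\phi$ is derivable from axioms and members of $\Gamma$ by these rules (both rules may be applied to any formulas already derived from $\Gamma$). A logic $\mathcal L$ whose language $\mathbf L$ includes a binary connective $\Rightarrow$, primitive or defined by a term in two variables, is implicative with respect to $\Rightarrow$ if for all formulas: (IL1) $\vdash_{\mathcal L}\alpha\Rightarrow\alpha$; (IL2) $\alpha\Rightarrow\beta,\ \beta\Rightarrow\gamma\vdash_{\mathcal L}\alpha\Rightarrow\gamma$; (IL3) for each connective $f\in\mathbf L$ of arity $n\ge1$, $\{\alpha_i\Rightarrow\beta_i,\ \beta_i\Rightarrow\alpha_i:1\le i\le n\}\vdash_{\mathcal L}f(\alpha_1,\dots,\alpha_n)\Rightarrow f(\beta_1,\dots,\beta_n)$; (IL4) $\alpha,\ \alpha\Rightarrow\beta\vdash_{\mathcal L}\beta$; (IL5) $\alpha\vdash_{\mathcal L}\beta\Rightarrow\alpha$. *)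

(* Defs.v *)
From Stdlib Require Import Vector Ensembles.
Import VectorNotations.

Set Implicit Arguments.
Unset Strict Implicit.

Record signature : Type := Signature {
  conn : Type;
  arity : conn -> nat
}.

Inductive term (S : signature) (V : Type) : Type :=
| Var : V -> term S V
| App : forall f : conn S, Vector.t (term S V) (arity f) -> term S V.

Arguments Var {S V} v.
Arguments App {S V} f args.

Fixpoint subst {S : signature} {V W : Type} (sigma : V -> term S W)
  (t : term S V) : term S W :=
  match t with
  | Var v => sigma v
  | App f args => App f (Vector.map (subst sigma) args)
  end.

Definition formula (S : signature) : Type := term S nat.

(* Binary connectives, primitive or defined, are terms in the two variables
   [lhs] and [rhs]; a primitive connective [f] is the term [f (lhs, rhs)]. *)
Inductive side : Type := lhs | rhs.

Definition binary_term (S : signature) : Type := term S side.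

Definition apply2 {S : signature} {V : Type} (t : binary_term S)
  (a b : term S V) : term S V :=
  subst (fun s => match s with lhs => a | rhs => b end) t.

Record logic : Type := Logic {
  lang : signature;
  entails : Ensemble (formula lang) -> formula lang -> Prop;
  entails_refl : forall Gamma phi, In _ Gamma phi -> entails Gamma phi;
  entails_cut : forall Gamma Delta phi,
    (forall psi, In _ Delta psi -> entails Gamma psi) ->
    entails Delta phi -> entails Gamma phi;
  entails_subst : forall (sigma : nat -> formula lang) Gamma phi,
    entails Gamma phi ->
    entails (fun chi => exists2 psi, In _ Gamma psi & chi = subst sigma psi)
      (subst sigma phi)
}.

Arguments entails l Gamma phi : clear implicits.

Record implicative (L : logic) (t : binary_term (lang L)) : Prop := {
  IL1 : forall a : formula (lang L),
    entails L (Empty_set _) (apply2 t a a);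
  IL2 : forall a b c : formula (lang L),
    entails L (Couple _ (apply2 t a b) (apply2 t b c)) (apply2 t a c);
  IL3 : forall (f : conn (lang L)) (a b : Vector.t (formula (lang L)) (arity f)),
    1 <= arity f ->
    entails L
      (fun chi => exists i : Fin.t (arity f),
         chi = apply2 t a[@i] b[@i] \/ chi = apply2 t b[@i] a[@i])
      (apply2 t (App f a) (App f b));
  IL4 : forall a b : formula (lang L),
    entails L (Couple _ a (apply2 t a b)) b;
  IL5 : forall a b : formula (lang L),
    entails L (Singleton _ a) (apply2 t b a)
}.

Arguments implicative L t : clear implicits.

Inductive dh_conn : Type := Or | And | Imp | Neg | Bot | Top.

Definition dh_sig : signature := {|
  conn := dh_conn;
  arity f := match f with Or | And | Imp => 2 | Neg => 1 | Bot | Top => 0 end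
|}.

Notation dh_term V := (term dh_sig V).

Declare Scope dh_scope.
Delimit Scope dh_scope with dh.

Definition dh_or {V} (a b : dh_term V) : dh_term V := @App dh_sig V Or [a; b].
Definition dh_and {V} (a b : dh_term V) : dh_term V := @App dh_sig V And [a; b].
Definition dh_imp {V} (a b : dh_term V) : dh_term V := @App dh_sig V Imp [a; b].
Definition dh_neg {V} (a : dh_term V) : dh_term V := @App dh_sig V Neg [a].
Definition dh_bot {V} : dh_term V := @App dh_sig V Bot [].
Definition dh_top {V} : dh_term V := @App dh_sig V Top [].

Definition dh_impH {V} (a b : dh_term V) : dh_term V := dh_imp a (dh_and a b).

Notation "a ∨ b" := (dh_or a b) (at level 50, left associativity) : dh_scope.
Notation "a ∧ b" := (dh_and a b) (at level 40, left associativity) : dh_scope.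
Notation "∼ a" := (dh_neg a) (at level 35, right associativity) : dh_scope.
Notation "a ⇒ b" := (dh_imp a b) (at level 55, right associativity) : dh_scope.
Notation "a ⇒H b" := (dh_impH a b) (at level 55, right associativity) : dh_scope.
Notation "⊥" := dh_bot : dh_scope.
Notation "⊤" := dh_top : dh_scope.

Definition impH_term : binary_term dh_sig := dh_impH (Var lhs) (Var rhs).

Lemma apply2_impH (V : Type) (a b : dh_term V) :
  apply2 impH_term a b = dh_impH a b.
Proof. reflexivity. Qed.

Local Open Scope dh_scope.

Inductive dhmsh_axiom : formula dh_sig -> Prop :=
| A1 a b : dhmsh_axiom (a ⇒H (a ∨ b))
| A2 a b : dhmsh_axiom (b ⇒H (a ∨ b))
| A3 a b c : dhmsh_axiom ((a ⇒H c) ⇒H ((b ⇒H c) ⇒H ((a ∨ b) ⇒H c)))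
| A4 a b : dhmsh_axiom ((a ∧ b) ⇒H a)
| A5 a b c : dhmsh_axiom ((c ⇒H a) ⇒H ((c ⇒H b) ⇒H (c ⇒H (a ∧ b))))
| A6 : dhmsh_axiom ⊤
| A7 a : dhmsh_axiom (⊥ ⇒H a)
| A8 a b c : dhmsh_axiom (((a ∧ b) ⇒H c) ⇒H (a ⇒H (b ⇒H c)))
| A9 a b c : dhmsh_axiom ((a ⇒H (b ⇒H c)) ⇒H ((a ∧ b) ⇒H c))
| A10 a b c :
    dhmsh_axiom ((a ⇒H b) ⇒H ((b ⇒H a) ⇒H ((a ⇒ c) ⇒H (b ⇒ c))))
| A11 a b c :
    dhmsh_axiom ((a ⇒H b) ⇒H ((b ⇒H a) ⇒H ((c ⇒ b) ⇒H (c ⇒ a))))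
| A12 : dhmsh_axiom (⊤ ⇒H ∼ ⊥)
| A13 : dhmsh_axiom (∼ ⊤ ⇒H ⊥)
| A14 a b : dhmsh_axiom (∼ (a ∧ b) ⇒H (∼ a ∨ ∼ b)).

Inductive dhmsh_derivable (Gamma : Ensemble (formula dh_sig)) :
  formula dh_sig -> Prop :=
| D_hyp phi : In _ Gamma phi -> dhmsh_derivable Gamma phi
| D_axiom phi : dhmsh_axiom phi -> dhmsh_derivable Gamma phi
| D_SMP phi gamma :
    dhmsh_derivable Gamma phi -> dhmsh_derivable Gamma (phi ⇒H gamma) ->
    dhmsh_derivable Gamma gamma
| D_SCP phi gamma :
    dhmsh_derivable Gamma (phi ⇒H gamma) ->
    dhmsh_derivable Gamma (∼ gamma ⇒H ∼ phi).

Lemma dhmsh_cut Gamma Delta phi :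
  (forall psi, In _ Delta psi -> dhmsh_derivable Gamma psi) ->
  dhmsh_derivable Delta phi -> dhmsh_derivable Gamma phi.
Proof.
intros H D; induction D as [phi Hp|phi Hp|phi g _ IH1 _ IH2|phi g _ IH].
- exact (H _ Hp).
- exact (D_axiom _ Hp).
- exact (D_SMP IH1 IH2).
- exact (D_SCP IH).
Qed.

Lemma dhmsh_axiom_subst (sigma : nat -> formula dh_sig) phi :
  dhmsh_axiom phi -> dhmsh_axiom (subst sigma phi).
Proof. intros []; constructor. Qed.

Lemma dhmsh_subst (sigma : nat -> formula dh_sig) Gamma phi :
  dhmsh_derivable Gamma phi ->
  dhmsh_derivable
    (fun chi => exists2 psi, In _ Gamma psi & chi = subst sigma psi)
    (subst sigma phi).
Proof.
intros D; induction D as [phi Hp|phi Hp|phi g _ IH1 _ IH2|phi g _ IH].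
- apply D_hyp; exists phi; [exact Hp | reflexivity].
- exact (D_axiom _ (dhmsh_axiom_subst sigma Hp)).
- exact (D_SMP IH1 IH2).
- exact (D_SCP IH).
Qed.

Definition DHMSH : logic := {|
  lang := dh_sig;
  entails := dhmsh_derivable;
  entails_refl := D_hyp;
  entails_cut := dhmsh_cut;
  entails_subst := dhmsh_subst
|}.

(* Main.v *)
From Stdlib Require Import Vector Ensembles Lia.
Require Import Defs.
Import VectorNotations.

(** Everything reduces to the usual laws of a positive implication for [⇒H]:
    weakening, identity, the two projections of [∧], and transitivity.  With
    these, (IL1), (IL2), (IL4) and (IL5) are immediate, and (IL3) follows from
    (A1)-(A5) for [∨] and [∧], from (A10)-(A11) for [⇒], and from (SCP) for [∼].

    The axioms contain no form of transitivity of [⇒H], and [∧] has only its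
    first projection (A4), so these laws have to be extracted from the fact that
    [a ⇒H b] unfolds to [a ⇒ (a ∧ b)], together with the replacement axioms
    (A10) and (A11) for the primitive [⇒].

    - Weakening is (A4) curried by (A8).
    - Identity ([der_id]): if [a ⇒H b], then [a ∧ b] and [a ∧ a] imply each
      other, so (A11) turns [a ⇒ (a ∧ b)] into [a ⇒ (a ∧ a)]; it applies with
      [b := a ∨ a] by (A1).  The second projection follows by (A9).
    - Replacement of the conclusion by an equivalent one ([der_equiv_r]) is
      obtained in the same way.  Applied to the equivalence (A8)-(A9) it shows
      that [(a ∧ b) ∧ c] and [a ∧ (b ∧ c)] have the same consequences
      ([der_assoc]); hence an iterated conjunction implies each of its members.
      From this, premises [a ∧ b] can be commuted ([der_comm]).
    - Transitivity ([der_trans]): if [a ⇒H b] and [b ⇒H c], then [a] is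
      equivalent to [a ∧ b], which implies [c].  By (A10) this gives
      [a ⇒ ((a ∧ b) ∧ c)], and (A11) replaces [(a ∧ b) ∧ c] by the equivalent
      [a ∧ c]. *)

Local Open Scope dh_scope.

Section Derivations.

(* All derivations below take place over an arbitrary set of hypotheses. *)
Variable Gamma : Ensemble (formula dh_sig).

Local Notation "|- a" := (dhmsh_derivable Gamma a) (at level 70).

Implicit Types a b c d : formula dh_sig.

(** * Rule forms of the axioms *)

Lemma der_mp a b : |- a ⇒H b -> |- a -> |- b.
Proof. intros H1 H2; exact (D_SMP H2 H1). Qed.

Lemma der_curry a b c : |- (a ∧ b) ⇒H c -> |- a ⇒H (b ⇒H c).
Proof. apply der_mp, D_axiom, A8. Qed.

Lemma der_uncurry a b c : |- a ⇒H (b ⇒H c) -> |- (a ∧ b) ⇒H c.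
Proof. apply der_mp, D_axiom, A9. Qed.

Lemma der_proj1 a b : |- (a ∧ b) ⇒H a.
Proof. apply D_axiom, A4. Qed.

Lemma der_pair a b c : |- c ⇒H a -> |- c ⇒H b -> |- c ⇒H (a ∧ b).
Proof.
intros Ha Hb.
exact (der_mp _ _ (der_mp _ _ (D_axiom _ (A5 a b c)) Ha) Hb).
Qed.

Lemma der_case a b c : |- a ⇒H c -> |- b ⇒H c -> |- (a ∨ b) ⇒H c.
Proof.
intros Ha Hb.
exact (der_mp _ _ (der_mp _ _ (D_axiom _ (A3 a b c)) Ha) Hb).
Qed.

Lemma der_imp_l a b c :
  |- a ⇒H b -> |- b ⇒H a -> |- (a ⇒ c) ⇒H (b ⇒ c).
Proof.
intros Hab Hba.
exact (der_mp _ _ (der_mp _ _ (D_axiom _ (A10 a b c)) Hab) Hba).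
Qed.

Lemma der_imp_r a b c :
  |- a ⇒H b -> |- b ⇒H a -> |- (c ⇒ a) ⇒H (c ⇒ b).
Proof.
intros Hab Hba.
exact (der_mp _ _ (der_mp _ _ (D_axiom _ (A11 b a c)) Hba) Hab).
Qed.

(** * Weakening, identity and projections *)

Lemma der_weaken a b : |- a -> |- b ⇒H a.
Proof. apply der_mp, der_curry, der_proj1. Qed.

(** The conclusion of [a ⇒H b] can be replaced as soon as [a ∧ b] and [a ∧ c]
    imply each other, since [a ⇒H b] is [a ⇒ (a ∧ b)]. *)
Lemma der_replace a b c :
  |- (a ∧ b) ⇒H c -> |- (a ∧ c) ⇒H b -> |- a ⇒H b -> |- a ⇒H c.
Proof.
intros Hbc Hcb; apply der_mp, der_imp_r; apply der_pair;
  assumption || apply der_proj1.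
Qed.

Lemma der_id a : |- a ⇒H a.
Proof.
assert (H : |- a ⇒H (a ∨ a)) by apply D_axiom, A1.
apply der_replace with (a ∨ a).
- apply der_proj1.
- apply der_uncurry, der_weaken, H.
- exact H.
Qed.

Lemma der_proj2 a b : |- (a ∧ b) ⇒H b.
Proof. apply der_uncurry, der_weaken, der_id. Qed.

Lemma der_equiv_r a b c :
  |- b ⇒H c -> |- c ⇒H b -> |- a ⇒H b -> |- a ⇒H c.
Proof.
intros Hbc Hcb; apply der_replace; apply der_uncurry, der_weaken; assumption.
Qed.

(** * Reordering conjunctive premises *)

Lemma der_assoc a b c d : |- (a ∧ (b ∧ c)) ⇒H d -> |- ((a ∧ b) ∧ c) ⇒H d.
Proof.
intros H; apply der_uncurry, der_uncurry.
apply der_equiv_r with ((b ∧ c) ⇒H d).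
- apply D_axiom, A8.
- apply D_axiom, A9.
- apply der_curry, H.
Qed.

Lemma der_proj11 a b c : |- ((a ∧ b) ∧ c) ⇒H a.
Proof. apply der_assoc, der_proj1. Qed.

Lemma der_proj12 a b c : |- ((a ∧ b) ∧ c) ⇒H b.
Proof. apply der_assoc, der_uncurry, der_weaken, der_proj1. Qed.

Lemma der_comm a b c : |- (a ∧ b) ⇒H c -> |- (b ∧ a) ⇒H c.
Proof.
intros H.
assert (swap : forall x y, |- (x ∧ y) ⇒H (y ∧ x))
  by (intros; apply der_pair; [apply der_proj2 | apply der_proj1]).
assert (swap3 : forall x y z, |- ((x ∧ y) ∧ z) ⇒H ((y ∧ x) ∧ z))
  by (intros; repeat apply der_pair;
      [apply der_proj12 | apply der_proj11 | apply der_proj2]).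
(* Now [H] reads [(a ∧ b) ⇒ ((a ∧ b) ∧ c)]; the two occurrences of [a ∧ b] are
   exchanged one after the other. *)
apply (der_mp _ _ (der_imp_r _ _ (b ∧ a) (swap3 a b c) (swap3 b a c))).
exact (der_mp _ _ (der_imp_l _ _ _ (swap a b) (swap b a)) H).
Qed.

(** * Transitivity *)

Lemma der_trans a b c : |- a ⇒H b -> |- b ⇒H c -> |- a ⇒H c.
Proof.
intros Hab Hbc.
assert (Habc : |- (a ∧ b) ⇒H c) by apply der_uncurry, der_weaken, Hbc.
assert (H1 : |- ((a ∧ b) ∧ c) ⇒H (a ∧ c))
  by (apply der_pair; [apply der_proj11 | apply der_proj2]).
assert (H2 : |- (a ∧ c) ⇒H ((a ∧ b) ∧ c)).
{ repeat apply der_pair; [apply der_proj1 | | apply der_proj2].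
  apply der_comm, der_uncurry, der_weaken, Hab. }
apply (der_mp _ _ (der_imp_r _ _ a H1 H2)).
assert (Ha : |- a ⇒H (a ∧ b)) by (apply der_pair; [apply der_id | exact Hab]).
exact (der_mp _ _ (der_imp_l _ _ _ (der_proj1 a b) Ha) Habc).
Qed.

(** * Compatibility with the connectives *)

Lemma der_or_mono a b c d :
  |- a ⇒H c -> |- b ⇒H d -> |- (a ∨ b) ⇒H (c ∨ d).
Proof.
intros Hac Hbd; apply der_case.
- apply der_trans with c; [exact Hac | apply D_axiom, A1].
- apply der_trans with d; [exact Hbd | apply D_axiom, A2].
Qed.

Lemma der_and_mono a b c d :
  |- a ⇒H c -> |- b ⇒H d -> |- (a ∧ b) ⇒H (c ∧ d).
Proof.
intros Hac Hbd; apply der_pair.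
- apply der_trans with a; [apply der_proj1 | exact Hac].
- apply der_trans with b; [apply der_proj2 | exact Hbd].
Qed.

Lemma der_imp_congr a b c d :
  |- a ⇒H c -> |- c ⇒H a -> |- b ⇒H d -> |- d ⇒H b ->
  |- (a ⇒ b) ⇒H (c ⇒ d).
Proof.
intros Hac Hca Hbd Hdb; apply der_trans with (c ⇒ b).
- apply der_imp_l; assumption.
- apply der_imp_r; assumption.
Qed.

End Derivations.

Lemma vector1_eta (A : Type) (v : Vector.t A 1) : v = [v[@Fin.F1]].
Proof.
apply (Vector.caseS' v); intros x w.
rewrite (Vector.nil_spec w); reflexivity.
Qed.

Lemma vector2_eta (A : Type) (v : Vector.t A 2) :
  v = [v[@Fin.F1]; v[@Fin.FS Fin.F1]].
Proof.
apply (Vector.caseS' v); intros x w; simpl; f_equal; apply vector1_eta.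
Qed.

Theorem theorem3p7 : implicative DHMSH impH_term.
Proof.
split.
- intros a; apply der_id.
- intros a b c; apply der_trans with b; apply D_hyp; constructor.
- intros f a b Hf.
  set (Gamma := fun chi => _).
  assert (Hab : forall i, dhmsh_derivable Gamma (a[@i] ⇒H b[@i]))
    by (intros i; apply D_hyp; exists i; left; reflexivity).
  assert (Hba : forall i, dhmsh_derivable Gamma (b[@i] ⇒H a[@i]))
    by (intros i; apply D_hyp; exists i; right; reflexivity).
  clearbody Gamma; destruct f; simpl in *; try lia.
  + rewrite (vector2_eta _ a), (vector2_eta _ b); apply der_or_mono; apply Hab.
  + rewrite (vector2_eta _ a), (vector2_eta _ b); apply der_and_mono; apply Hab.
  + rewrite (vector2_eta _ a), (vector2_eta _ b).
    apply der_imp_congr; apply Hab || apply Hba.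
  + rewrite (vector1_eta _ a), (vector1_eta _ b); apply D_SCP, Hba.
- intros a b; apply der_mp with a; apply D_hyp; constructor.
- intros a b; apply der_weaken, D_hyp; constructor.
Qed.
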